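(* There exist absolute constants $K_0 > 1$ and $\alpha > 0$ such that the following holds. Let $T$ be a (finite) rooted tree with maximum degree $D$, and suppose $G$ is an $(n, d, \lambda)$-graph with $\lambda < \alpha d / D$. Given a non-empty subset $U \subseteq V(T)$ and a vertex $x \in V(G)$, let $X$ denote the number of vertices from $U$ which are mapped to $x$ in a random $T$-walk on $G$. Then $\mathbb{E}[X] = |U|/n$ and $$\Pr\left[X > K\, \mathbb{E}[X]\right] \le e^{-(K - K_0)\mathbb{E}[X]}$$ for every real $K > K_0$.
   Context: An $(n,d,\lambda)$-graph is a $d$-regular graph on $n$ vertices such that the second largest absolute value of an eigenvalue of its adjacency matrix (eigenvalues counted with multiplicity) is at most $\lambda$; that is, if $d = \lambda_1 \ge \lambda_2 \ge \dots \ge \lambda_n$ are the eigenvalues, then $\max(|\lambda_2|, |\lambda_n|) \le \lambda$. For a rooted tree $T$ and a graph $G$, a random $T$-walk on $G$ is the random homomorphism $\phi \colon T \to G$ generated as follows. Let $t_1, \ldots, t_N$ be any ordering of the vertices of $T$ such that $t_1$ is the root, and if $t_i$ is closer to the root than $t_j$ then $i < j$. Choose $\phi(t_1)$ uniformly at random from $V(G)$, and for $i \ge 2$, sequentially, choose $\phi(t_i)$ uniformly at random (independently of the earlier choices, given $\phi(p_i)$) from the set of neighbours of $\phi(p_i)$ in $G$, where $p_i$ is the parent of $t_i$. The distribution of $\phi$ does not depend on the chosen ordering. *)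

(* Defs.v *)
From HB Require Import structures.
From mathcomp Require Export all_boot all_order all_algebra.
From mathcomp Require Export all_classical all_reals all_analysis.

Set Implicit Arguments.
Unset Strict Implicit.
Unset Printing Implicit Defensive.

Import Order.TTheory GRing.Theory Num.Theory.
Local Open Scope classical_set_scope.
Local Open Scope ring_scope.

Definition simple_graph (V : finType) (e : rel V) : Prop :=
  symmetric e /\ irreflexive e.

Definition nbrs (V : finType) (e : rel V) (v : V) : {set V} :=
  [set w | e v w]%SET.

Definition regular (V : finType) (e : rel V) (d : nat) : Prop :=
  forall v : V, #|nbrs e v| = d.

Definition max_degree (V : finType) (e : rel V) : nat :=
  (\max_(v : V) #|nbrs e v|)%N.

Definition adjmx (R : nzRingType) (V : finType) (e : rel V) : 'M[R]_#|V| :=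
  \matrix_(i, j) (e (enum_val i) (enum_val j))%:R.

(* s = [:: lambda_1; ...; lambda_m] lists the eigenvalues of A with (algebraic)
   multiplicity, in non-increasing order. *)
Definition spectrum (R : realType) (m : nat) (A : 'M[R]_m) (s : seq R) : Prop :=
  sorted >=%R s /\ char_poly A = \prod_(a <- s) ('X - a%:P).

(* With 0-based indexing, s`_1 is lambda_2 and s`_n.-1 is lambda_n; for n = 1
   there is no lambda_2 and s`_1 is the default value 0. *)
Definition ndl_graph (R : realType) (V : finType) (e : rel V)
    (n d : nat) (lambda : R) : Prop :=
  [/\ simple_graph e, #|V| = n, regular e d &
      exists2 s : seq R, spectrum (adjmx R e) s &
        Num.max `|s`_1| `|s`_n.-1| <= lambda].

(* For a symmetric irreflexive relation, a duplicate-free closed walk of length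
   at least 3 is a cycle of the graph. *)
Definition tree (W : finType) (t : rel W) : Prop :=
  [/\ simple_graph t,
      forall x y : W, connect t x y &
      forall c : seq W, ucycle t c -> (size c <= 2)%N].

(* Length of a shortest walk from x to y (and #|W| if there is none). *)
Definition dist (W : finType) (t : rel W) (x y : W) : nat :=
  find (fun k => [exists p : k.-tuple W, path t x p && (last x p == y)])
       (iota 0 #|W|).

Definition is_parent (W : finType) (t : rel W) (root p v : W) : bool :=
  t v p && (dist t root p < dist t root v)%N.

Definition generation_order (W : finType) (t : rel W) (root : W)
    (s : seq W) : Prop :=
  [/\ perm_eq s (enum W), index root s = 0%N &
      forall u v : W, (dist t root u < dist t root v)%N ->
        (index u s < index v s)%N].

Definition unif_pmf (R : realType) (V : finType) (A : {set V}) (y : V) : R :=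
  if y \in A then #|A|%:R^-1 else 0.

(* phi is a random T-walk on the graph e, where T = (t, root): the root has a
   uniform image, and conditionally on the images f of all the vertices
   generated before v, the image of v is uniform on the neighbours of f p, with
   p the parent of v.  The conditional law is stated in product form, so that
   pasts of probability 0 need no separate treatment. *)
Definition random_Twalk (R : realType) (W : finType) (t : rel W) (root : W)
    (V : finType) (e : rel V) (d : measure_display) (Omega : measurableType d)
    (P : probability Omega R) (phi : Omega -> W -> V) : Prop :=
  (forall (v : W) (y : V), measurable [set w | phi w v = y]) /\
  exists2 s : seq W, generation_order t root s &
    (forall y : V, P [set w | phi w root = y] = (unif_pmf R [set: V]%SET y)%:E) /\
    (forall (v p : W), is_parent t root p v ->
     forall (f : W -> V) (y : V),
       let past := [set w | forall u : W, (index u s < index v s)%N ->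
                              phi w u = f u] in
       P (past `&` [set w | phi w v = y]) =
         (P past * (unif_pmf R (nbrs e (f p)) y)%:E)%E).

Definition hits (W V : finType) (Omega : Type) (phi : Omega -> W -> V)
    (U : {set W}) (x : V) (w : Omega) : nat :=
  #|[set u in U | phi w u == x]%SET|.

(* Main.v *)
Require Import Defs.
From mathcomp Require Import spectral complex ring lra measurable_realfun.
Set Implicit Arguments.
Unset Strict Implicit.
Unset Printing Implicit Defensive.
Import Order.TTheory GRing.Theory Num.Theory.
Local Open Scope classical_set_scope.
Local Open Scope ring_scope.

(** By Chernoff's method it suffices to show E[exp X] <= exp (12 |U| / n).  Let
    K be the transition kernel of the walk on G, and for a vertex v of T let
    f_v(y) be the conditional expectation, given phi(v) = y, of exp of the
    number of hits at v and its descendants.  Removing the vertices of T one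
    by one, the last generated first, gives
      f_v = exp(1_[v in U] 1_x) * prod_(c child of v) K f_c
    and E[exp X] is the mean of f_root ([markov_product]).

    Since K fixes the constants and shrinks the l2 norm of every function of
    mean zero by eps = lambda / d ([ndl_contracts]), the functions f_v stay
    close to constants.  The invariant is [near_const]:
      f_v <= exp(a_v / n) (1 + g_v)  with  sum g_v = 0  and  |g_v|_2 <= b_v,
    where the l2 norm is not divided by n, so that a spike at the single vertex
    x costs O(1) and the norm dominates the supremum.  For the children c of v,
    prod_c (1 + K g_c) <= exp H with H = sum_c K g_c, where H has mean zero and
    norm at most s = sum_c eps b_c.  There are at most D children and eps D is
    small, so s <= 1/2 and exp H <= 1 + H + 2 H^2.  The linear term has mean
    zero; so up to the factor 1/n the mean only grows by the quadratic term, at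
    most s, and by O(1) if v is in U.  This gives the recursions
      a_v = sum_c a_c + s + 6 [v in U],    b_v = 2 s + 6 [v in U].
    As eps <= 1/16, they imply
      a_v + b_v <= sum_c (a_c + b_c) + 12 [v in U],
    which telescopes over T to a_root <= 12 |U| ([tree_mgf_bound]).  That the
    increments of a are bounded by the norms b, which themselves decay away from
    U, is what makes the bound depend on |U| and not on |T|.

    The value of E[X] only uses that every phi(v) is uniform, because K is doubly
    stochastic ([markov_marginal]). *)

(** * Functions with bounded l2 norm *)

(** Stating norm bounds as a predicate avoids square roots. *)
Definition l2_le (R : realType) (V : finType) (f : V -> R) (s : R) : Prop :=
  0 <= s /\ \sum_y f y ^+ 2 <= s ^+ 2.

Lemma l2_le_coord (R : realType) (V : finType) (f : V -> R) (s : R) (y : V) :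
  l2_le f s -> `|f y| <= s.
Proof.
case=> s0 fs; rewrite -(ler_pXn2r (ltn0Sn 1)) ?nnegrE // real_normK ?num_real //.
apply: le_trans fs; rewrite (bigD1 y) //= lerDl.
by apply: sumr_ge0 => z _; apply: sqr_ge0.
Qed.

Lemma l2_le_dom (R : realType) (V : finType) (f g : V -> R) (s : R) :
  (forall y, `|g y| <= `|f y|) -> l2_le f s -> l2_le g s.
Proof.
move=> gf [s0 fs]; split=> //; apply: le_trans fs; apply: ler_sum => y _.
rewrite -[g y ^+ 2]real_normK ?num_real // -[f y ^+ 2]real_normK ?num_real //.
by rewrite ler_pXn2r ?nnegrE.
Qed.

(** Minkowski's inequality, from the weighted bound 2 f g <= (r/s) f^2 + (s/r) g^2,
    which is optimal for norms s and r. *)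
Lemma l2_le_add (R : realType) (V : finType) (f g : V -> R) (s r : R) :
  l2_le f s -> l2_le g r -> l2_le (fun y => f y + g y) (s + r).
Proof.
move=> [s0 fs] [r0 gr]; split; first exact: addr_ge0.
have null (h : V -> R) (q : R) : q = 0 -> \sum_y h y ^+ 2 <= q ^+ 2 ->
    forall y, h y = 0.
  move=> -> hq y; apply/eqP; rewrite -normr_le0.
  by apply: (@l2_le_coord R V h 0 y); split.
case: (eqVneq s 0) => [s00|sN0].
  rewrite (eq_bigr (fun y => g y ^+ 2)) ?s00 ?add0r // => y _.
  by rewrite (null f s) ?add0r.
case: (eqVneq r 0) => [r00|rN0].
  rewrite (eq_bigr (fun y => f y ^+ 2)) ?r00 ?addr0 // => y _.
  by rewrite (null g r) ?addr0.
have sp : 0 < s by rewrite lt_def sN0.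
have rp : 0 < r by rewrite lt_def rN0.
(* The weight for which the bound below is an equality between the norms. *)
pose a := r / s.
have ap : 0 < a by rewrite divr_gt0.
have pw y : (f y + g y) ^+ 2 <= (1 + a) * f y ^+ 2 + (1 + a^-1) * g y ^+ 2.
  have -> : (1 + a) * f y ^+ 2 + (1 + a^-1) * g y ^+ 2 =
      (f y + g y) ^+ 2 + a * (f y - a^-1 * g y) ^+ 2.
    by field; rewrite gt_eqF.
  by rewrite lerDl mulr_ge0 ?sqr_ge0 // ltW.
apply: le_trans (ler_sum _ (fun y _ => pw y)) _.
rewrite big_split /= -!mulr_sumr.
have -> : (s + r) ^+ 2 = (1 + a) * s ^+ 2 + (1 + a^-1) * r ^+ 2.
  by rewrite /a; field; rewrite sN0 rN0.
by rewrite lerD // ler_wpM2l // addr_ge0 // ?invr_ge0 ltW.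
Qed.

Lemma l2_le_sum (R : realType) (V I : finType) (P : pred I)
    (f : I -> V -> R) (s : I -> R) :
  (forall i, P i -> l2_le (f i) (s i)) ->
  l2_le (fun y => \sum_(i | P i) f i y) (\sum_(i | P i) s i).
Proof.
move=> fs; suff : forall r : seq I,
    l2_le (fun y => \sum_(i <- r | P i) f i y) (\sum_(i <- r | P i) s i) by apply.
elim=> [|i r IH].
  by rewrite big_nil; split=> //; rewrite big1 // => y _; rewrite big_nil expr0n.
rewrite big_cons.
have -> : (fun y => \sum_(j <- i :: r | P j) f j y) =
    (fun y => (if P i then f i y else 0) + \sum_(j <- r | P j) f j y).
  by apply/funext => y; rewrite big_cons; case: ifP => //; rewrite add0r.
case: ifP => Pi; first exact: l2_le_add (fs i Pi) IH.
by under eq_fun do rewrite add0r.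
Qed.

(** Subtracting its mean from a function is an orthogonal projection. *)
Lemma l2_le_center (R : realType) (V : finType) (f : V -> R) (s m : R) :
  \sum_y f y = m *+ #|V| -> l2_le f s -> l2_le (fun y => f y - m) s.
Proof.
move=> fm [s0 fs]; split=> //; apply: le_trans fs.
have -> : \sum_y (f y - m) ^+ 2 = \sum_y f y ^+ 2 - m ^+ 2 *+ #|V|.
  transitivity (\sum_y (f y ^+ 2 - 2 * m * f y + m ^+ 2)).
    by apply: eq_bigr => y _; ring.
  rewrite big_split sumrB /= sumr_const -mulr_sumr fm.
  by rewrite -[m *+ _]mulr_natr -[m ^+ 2 *+ _]mulr_natr; ring.
by rewrite lerBlDr lerDl mulrn_wge0 // sqr_ge0.
Qed.

(** * Two estimates on the exponential *)

(** Equivalent to 1 <= (1 + h + 2 h^2) exp(-h), where exp(-h) >= 1 - h and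
    (1 + h + 2 h^2)(1 - h) = 1 + h^2 (1 - 2h). *)
Lemma expR_le_quad (R : realType) (h : R) :
  `|h| <= 2^-1 -> expR h <= 1 + h + 2 * h ^+ 2.
Proof.
rewrite ler_norml => /andP[h1 h2].
have q0 : 0 <= 1 + h + 2 * h ^+ 2 by nra.
have e1 : 1 - h <= expR (- h) by apply: expR_ge1Dx.
have : 1 <= (1 + h + 2 * h ^+ 2) * expR (- h).
  apply: le_trans (ler_wpM2l q0 e1).
  have -> : (1 + h + 2 * h ^+ 2) * (1 - h) = 1 + h ^+ 2 * (1 - 2 * h) by ring.
  by rewrite lerDl mulr_ge0 ?sqr_ge0 //; lra.
by rewrite expRN ler_pdivlMr ?expR_gt0 // mul1r.
Qed.

Lemma expR1_le4 (R : realType) : expR 1 <= 4 :> R.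
Proof.
have e1 : 2^-1 <= expR (- 2^-1) :> R.
  by apply: le_trans (expR_ge1Dx _); lra.
have e2 : expR (- 2^-1) * expR (- 2^-1) * expR 1 = 1 :> R.
  by rewrite -!expRD -[RHS]expR0; congr expR; lra.
have e0 := expR_gt0 (1 : R).
have e3 : 2^-1 * 2^-1 <= expR (- 2^-1) * expR (- 2^-1) :> R by apply: ler_pM.
have := ler_wpM2r (ltW e0) e3; rewrite e2; lra.
Qed.

(** * Contracting doubly stochastic kernels *)

Definition kernel_avg (R : realType) (V : finType) (K : V -> V -> R) (g : V -> R)
    (y : V) : R := \sum_z K y z * g z.

Definition doubly_stochastic (R : realType) (V : finType) (K : V -> V -> R) :=
  [/\ forall y z, 0 <= K y z, forall y, \sum_z K y z = 1 &
      forall z, \sum_y K y z = 1].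

Definition contracts (R : realType) (V : finType) (K : V -> V -> R) (eps : R) :=
  forall (g : V -> R) (s : R), \sum_y g y = 0 -> l2_le g s ->
    l2_le (kernel_avg K g) (eps * s).

Lemma sum_kernel_avg (R : realType) (V : finType) (K : V -> V -> R) (g : V -> R) :
  doubly_stochastic K -> \sum_y kernel_avg K g y = \sum_y g y.
Proof.
case=> _ _ col; rewrite exchange_big /=.
by apply: eq_bigr => z _; rewrite -mulr_suml col mul1r.
Qed.

(** * Spectral gap: eigenvalues control the walk kernel *)

Lemma dotmx_sum (C : numClosedFieldType) (m : nat) (u : 'rV[C]_m) :
  (u *m (u ^t*)%sesqui) 0 0 = \sum_i `|u 0 i| ^+ 2.
Proof. by rewrite mxE; apply: eq_bigr => i _; rewrite !mxE normCK. Qed.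

Lemma char_poly_normal (C : numClosedFieldType) (m : nat) (A : 'M[C]_m) :
  A \is normalmx ->
  char_poly A = \prod_(i < m) ('X - (spectral_diag A 0 i)%:P).
Proof.
move=> /orthomx_spectralP; set P := spectralmx A; set D := spectral_diag A => AE.
have Pu : P \in unitmx by apply: unitarymx_unit; apply: spectral_unitarymx.
transitivity (char_poly (diag_mx D)); last first.
  rewrite char_poly_trig ?is_diag_mx_is_trig ?diag_mx_is_diag //.
  by apply: eq_bigr => i _; rewrite mxE eqxx.
have PV : map_mx polyC (invmx P) *m map_mx polyC P = 1%:M.
  by rewrite -map_mxM mulVmx // map_mx1.
have -> : char_poly A = \det (map_mx polyC (invmx P) *m
    char_poly_mx (diag_mx D) *m map_mx polyC P).
  congr (\det _); rewrite /char_poly_mx mulmxBr mulmxBl -!map_mxM /=.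
  rewrite mul_mx_scalar -scalemxAl PV scale_scalar_mx mulr1.
  by rewrite {1}AE.
by rewrite !det_mulmx mulrAC -det_mulmx PV det1 mul1r.
Qed.

(** In an orthonormal eigenbasis, at most one coordinate belongs to an eigenvalue
    exceeding [lam]; the eigenvector [o] has such an eigenvalue, so it is supported
    on that coordinate, which therefore vanishes for every [u] orthogonal to [o]. *)
Lemma normal_contraction (C : numClosedFieldType) (m : nat) (A : 'M[C]_m)
    (d lam : C) (o u : 'rV[C]_m) :
  A \is normalmx -> 0 <= lam -> ~~ (`|d| <= lam) ->
  leq #|[pred i | ~~ (`|spectral_diag A 0 i| <= lam)]| 1 ->
  o != 0 -> o *m A = d *: o -> (u *m (o ^t*)%sesqui) 0 0 = 0 ->
  \sum_i `|(u *m A) 0 i| ^+ 2 <= lam ^+ 2 * \sum_i `|u 0 i| ^+ 2.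
Proof.
move=> An lam0 dlam /card_le1_eqP bad o0 oA uo.
have /orthomx_spectralP := An; set P := spectralmx A; set D := spectral_diag A.
have Pu : P \is unitarymx by apply: spectral_unitarymx.
rewrite (invmx_unitary Pu) => AE.
have isom (v : 'rV[C]_m) : \sum_i `|(v *m P) 0 i| ^+ 2 = \sum_i `|v 0 i| ^+ 2.
  rewrite -!dotmx_sum trmx_mul map_mxM mulmxA; congr ((_ *m _) 0 0).
  by rewrite mulmxtVK.
pose Q := (P ^t*)%sesqui; pose c := u *m Q; pose w := o *m Q.
have uE : u = c *m P by rewrite mulmxKtV.
have oE : o = w *m P by rewrite mulmxKtV.
have wDE : w *m diag_mx D = d *: w.
  by rewrite scalemxAl -oA {1}AE !mulmxA mulmxtVK.
(* The definitions of [c] and [w] must not be unfolded by [mxE] below. *)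
clearbody c w.
have wD i : w 0 i != 0 -> D 0 i = d.
  move/rowP: wDE => /(_ i); rewrite mul_mx_diag !mxE => e wi.
  by apply: (mulfI wi); rewrite e mulrC.
have [j wj] : exists j, w 0 j != 0.
  apply/existsP; apply: contraNT o0 => /existsPn w0; apply/eqP.
  rewrite oE; suff -> : w = 0 by rewrite mul0mx.
  by apply/rowP => i; rewrite mxE; apply/eqP/negPn/w0.
have badj : j \in [pred i | ~~ (`|D 0 i| <= lam)] by rewrite inE wD.
have w0 i : i != j -> w 0 i = 0.
  move=> ij; apply/eqP; apply: contraNT ij => wi; apply/eqP; apply: bad => //.
  by rewrite inE wD.
have cj : c 0 j = 0.
  have : (c *m (w ^t*)%sesqui) 0 0 = 0.
    rewrite -uo uE oE trmx_mul map_mxM mulmxA mulmxtVK //.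
  rewrite mxE (bigD1 j) //= big1 ?addr0; last first.
    by move=> i ij; rewrite !mxE w0 // rmorph0 mulr0.
  by move/eqP; rewrite !mxE mulf_eq0 conjC_eq0 (negPf wj) orbF => /eqP.
rewrite uE AE !mulmxA mulmxtVK // !isom mulr_sumr.
apply: ler_sum => i _; rewrite mul_mx_diag mxE normrM exprMn mulrC.
have [->|ij] := eqVneq i j; first by rewrite cj normr0 expr0n !mulr0.
have : `|D 0 i| <= lam.
  by rewrite -[_ <= _]negbK; apply: contra ij => bi; apply/eqP; apply: bad.
move=> Dl; apply: ler_wpM2r; first by rewrite exprn_ge0.
by rewrite ler_pXn2r // nnegrE.
Qed.

(** The characteristic polynomial identifies the list [s] with the diagonal of the
    complex spectral decomposition, and since [s] is sorted every entry but the
    first lies between [s`_1] and [s`_m.-1]. *)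
Lemma real_symmetric_contraction (R : realType) (m : nat) (A : 'M[R]_m)
    (s : seq R) (d lam : R) (u : 'rV[R]_m) :
  A^T = A -> spectrum A s -> Num.max `|s`_1| `|s`_m.-1| <= lam -> lam < d ->
  (const_mx 1 : 'rV_m) *m A = d *: const_mx 1 -> \sum_i u 0 i = 0 ->
  \sum_i (u *m A) 0 i ^+ 2 <= lam ^+ 2 * \sum_i u 0 i ^+ 2.
Proof.
move=> Asym [ss cp] slam lamd A1 u0.
pose toC := real_complex R.
case: m => [|m] in A u Asym ss cp slam A1 u0 *; first by rewrite !big_ord0 mulr0.
have lam0 : 0 <= lam by apply: le_trans slam; rewrite le_max normr_ge0.
have ssz : size s = m.+1.
  have := size_char_poly A; rewrite cp size_prod_XsubC => -[//].
have Ac : map_mx toC A \is normalmx.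
  apply: hermitian_normalmx; apply/is_hermitianmxP; rewrite expr0 scale1r.
  apply/matrixP => i j; rewrite !mxE -{1}Asym mxE.
  by symmetry; exact: conjc_real.
have lec : forall z : R, (`|toC z| <= toC lam) = (`|z| <= lam).
  by move=> z; rewrite normc_def /= expr0n addr0 sqrtr_sqr lecR.
have cnt : leq #|[pred i | ~~ (`|spectral_diag (map_mx toC A) 0 i| <= toC lam)]| 1.
  have pe : perm_eq [seq spectral_diag (map_mx toC A) 0 i | i <- enum 'I_m.+1]
      [seq toC z | z <- s].
    apply: prod_XsubC_eq; rewrite big_map big_enum /= -char_poly_normal //.
    rewrite -map_char_poly cp rmorph_prod big_map /=.
    by apply: eq_bigr => z _; rewrite rmorphB /= map_polyX map_polyC.
  have := permP pe (fun z => ~~ (`|z| <= toC lam)).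
  rewrite !count_map => e.
  have -> : #|[pred i | ~~ (`|spectral_diag (map_mx toC A) 0 i| <= toC lam)]| =
      count (fun z => ~~ (`|z| <= lam)) s.
    rewrite (eq_count (a2 := preim toC (fun z => ~~ (`|z| <= toC lam)))) => [|z].
      by rewrite -e cardE -size_filter /enum_mem.
    by rewrite /= lec.
  case: (s) ss ssz slam => // s0 s' ss [ssz] slam.
  rewrite /= (_ : count _ s' = 0%N) ?addn0 ?leq_b1 //.
  apply/eqP; rewrite -leqn0 leqNgt -has_count; apply/hasPn => z zs'.
  rewrite negbK; have [k ks <-] := nthP 0 zs'.
  have mono i j : (i <= j <= size s')%N -> (s0 :: s')`_j <= (s0 :: s')`_i.
    case/andP=> ij js.
    have := @sorted_leq_nth R >=%R ge_trans ge_refl 0 (s0 :: s') ss i j.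
    by rewrite !inE /= !ltnS js (leq_trans ij js); apply.
  have h1 := mono 1%N k.+1; have h2 := mono k.+1 (size s').
  move: slam; rewrite ge_max /= -ssz !ler_norml.
  move: h1 h2; rewrite ks leqnn /= => /(_ isT) h1 /(_ isT) h2.
  by case/andP=> /andP[a1 a2] /andP[a3 a4]; apply/andP; split; lra.
have dlam : ~~ (`|toC d| <= toC lam).
  by rewrite lec ger0_norm -?ltNge // ltW // (le_lt_trans lam0).
have := @normal_contraction _ m.+1 (map_mx toC A) (toC d) (toC lam)
  (map_mx toC (const_mx 1)) (map_mx toC u) Ac _ dlam cnt.
rewrite -!map_mxM A1 map_mxZ /= => H.
have sq (v : 'rV[R]_m.+1) : \sum_i `|map_mx toC v 0 i| ^+ 2 =
    toC (\sum_i v 0 i ^+ 2).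
  rewrite /toC rmorph_sum; apply: eq_bigr => i _.
  by rewrite mxE -normrX -rmorphXn ger0_norm // lecR sqr_ge0.
rewrite -lecR; move: H; rewrite !sq -rmorphXn -rmorphM; apply=> //.
- by rewrite lecR.
- by apply/eqP => /rowP/(_ 0); rewrite !mxE => -[/eqP]; rewrite oner_eq0.
rewrite mxE -[RHS](rmorph0 (real_complex R)) -u0 rmorph_sum; apply: eq_bigr => i _.
by rewrite !mxE /toC !rmorph1 mulr1.
Qed.

Lemma walk_kernelE (R : realType) (V : finType) (e : rel V) (d : nat)
    (g : V -> R) (y : V) :
  regular e d ->
  kernel_avg (fun y z => unif_pmf R (nbrs e y) z) g y =
  d%:R^-1 * \sum_z (e y z)%:R * g z.
Proof.
move=> reg; rewrite /kernel_avg mulr_sumr; apply: eq_bigr => z _.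
rewrite /unif_pmf reg inE; case: (e y z); last by rewrite !mul0r mulr0.
by rewrite mul1r.
Qed.

(** The kernel is symmetric because all vertices have the same degree. *)
Lemma walk_doubly_stochastic (R : realType) (V : finType) (e : rel V) (d : nat) :
  simple_graph e -> regular e d -> (0 < d)%N ->
  doubly_stochastic (fun y z => unif_pmf R (nbrs e y) z).
Proof.
move=> [sym _] reg d0.
have row y : \sum_z unif_pmf R (nbrs e y) z = 1.
  rewrite -big_mkcond sumr_const !reg -[LHS]mulr_natr mulVf //.
  by rewrite pnatr_eq0 -lt0n.
split=> // [y z|z].
  by rewrite /unif_pmf; case: ifP; rewrite // invr_ge0.
by rewrite -[RHS](row z); apply: eq_bigr => y _; rewrite /unif_pmf !reg !inE sym.
Qed.

Lemma ndl_lambda_ge0 (R : realType) (V : finType) (e : rel V) (n d : nat)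
    (lambda : R) :
  ndl_graph e n d lambda -> 0 <= lambda.
Proof. by case=> _ _ _ [s _]; apply: le_trans; rewrite le_max normr_ge0. Qed.

(** The kernel is the adjacency matrix divided by [d], and the constant vectors are
    eigenvectors for [d], an eigenvalue larger than [lambda]; functions of mean
    zero are those orthogonal to them. *)
Lemma ndl_contracts (R : realType) (V : finType) (e : rel V) (n d : nat)
    (lambda : R) :
  ndl_graph e n d lambda -> lambda < d%:R ->
  contracts (fun y z => unif_pmf R (nbrs e y) z) (lambda / d%:R).
Proof.
move=> ndl ld g s g0 [s0 gs].
have lam0 := ndl_lambda_ge0 ndl.
have d0 : 0 < d%:R :> R by apply: le_lt_trans ld.
case: ndl => -[sym _] Vn reg [sp spE lamE].
split; first by rewrite mulr_ge0 // divr_ge0 // ltW.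
under eq_bigr do rewrite (walk_kernelE _ _ reg) exprMn.
rewrite -mulr_sumr 2!exprMn [X in _ <= X * _]mulrC -[leRHS]mulrA ler_wpM2l ?sqr_ge0 //.
apply: le_trans (ler_wpM2l (sqr_ge0 lambda) gs).
pose u : 'rV[R]_#|V| := \row_i g (enum_val i).
have val (F : V -> R) : \sum_y F y = \sum_(i < #|V|) F (enum_val i).
  by rewrite (reindex _ (onW_bij _ (enum_val_bij V))).
have uA : forall i, (u *m adjmx R e) 0 i = \sum_z (e (enum_val i) z)%:R * g z.
  by move=> i; rewrite mxE val; apply: eq_bigr => j _; rewrite !mxE sym mulrC.
rewrite val [in leRHS]val.
under eq_bigr do rewrite -uA.
have uE i : g (enum_val i) = u 0 i by rewrite mxE.
under [X in _ <= _ * X]eq_bigr do rewrite uE.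
apply: (real_symmetric_contraction _ spE _ ld).
- by apply/matrixP => i j; rewrite !mxE sym.
- by rewrite Vn.
- apply/rowP => i; rewrite !mxE mulr1.
  rewrite -(reg (enum_val i)) -sum1_card natr_sum [RHS]big_mkcond [RHS]val.
  by apply: eq_bigr => j _; rewrite !mxE mul1r sym inE; case: (e _ _).
- by rewrite -[RHS]g0 [RHS]val; apply: eq_bigr => i _; rewrite mxE.
Qed.

(** * Functions dominated by a nearly constant function *)

(** The bound [b] is on the sum of the squares of [g], not on their mean, and [a] is
    measured on the scale [1 / #|V|], the increase of the mean of a function when
    its value at one vertex grows by 1. *)
Definition near_const (R : realType) (V : finType) (f : V -> R) (a b : R) :=
  exists g : V -> R, [/\ \sum_y g y = 0, l2_le g b &
    forall y, 0 <= f y <= expR (a / #|V|%:R) * (1 + g y)].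

Lemma near_const_avg (R : realType) (V : finType) (K : V -> V -> R) (eps : R)
    (f : V -> R) (a b : R) :
  doubly_stochastic K -> contracts K eps ->
  near_const f a b -> near_const (kernel_avg K f) a (eps * b).
Proof.
move=> dsK cK [g [g0 gb fg]]; exists (kernel_avg K g); split.
- by rewrite sum_kernel_avg.
- exact: cK.
move=> y; have [K0 row _] := dsK; apply/andP; split.
  by apply: sumr_ge0 => z _; rewrite mulr_ge0 //; case/andP: (fg z).
rewrite -[X in X + _](row y) -big_split /= mulr_sumr; apply: ler_sum => z _.
have /andP[_ h] := fg z.
by apply: le_trans (ler_wpM2l (K0 y z) h) _; rewrite mulrCA mulrDr mulr1.
Qed.

(** Bounding [1 + g i] by [exp (g i)] turns the product into the exponential of
    a sum, which still has mean zero. *)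
Lemma near_const_prod (R : realType) (V I : finType) (P : pred I)
    (f : I -> V -> R) (a b : I -> R) :
  (forall i, P i -> near_const (f i) (a i) (b i)) ->
  exists H : V -> R, [/\ \sum_y H y = 0, l2_le H (\sum_(i | P i) b i) &
    forall y, 0 <= \prod_(i | P i) f i y <=
      expR ((\sum_(i | P i) a i) / #|V|%:R) * expR (H y)].
Proof.
move=> nc.
have /choice[g gP] : forall i, exists g : V -> R, P i -> [/\ \sum_y g y = 0,
    l2_le g (b i) & forall y, 0 <= f i y <= expR (a i / #|V|%:R) * (1 + g y)].
  move=> i; case: (boolP (P i)) => [/nc[g gP]|_]; first by exists g.
  by exists (fun=> 0).
exists (fun y => \sum_(i | P i) g i y); split.
- by rewrite exchange_big big1 // => i /gP[].
- by apply: l2_le_sum => i /gP[].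
move=> y; rewrite mulr_suml !expR_sum -big_split /=; apply/andP; split.
  by apply: prodr_ge0 => i /gP[_ _ /(_ y)/andP[]].
apply: ler_prod => i /gP[_ _ /(_ y)/andP[-> /= /le_trans]]; apply.
by rewrite ler_wpM2l ?expR_ge0 ?expR_ge1Dx.
Qed.

(** As [exp (H y) <= 1 + H y + 2 * H y ^+ 2 <= 2] and [exp 1 - 1 <= 3], multiplying
    by the weight [exp 1] at [x] adds at most 6 there.  The product is thus
    dominated by [1 + H + q] with [q >= 0]; the mean [m] of [q] is moved into the
    constant, and the centred rest [H + q - m] is the new fluctuation. *)
Lemma near_const_step (R : realType) (V : finType) (x : V) (u : bool)
    (F H : V -> R) (a s : R) :
  \sum_y H y = 0 -> l2_le H s -> s <= 2^-1 ->
  (forall y, 0 <= F y <= expR (a / #|V|%:R) * expR (H y)) ->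
  near_const (fun y => expR (u && (y == x))%:R * F y)
    (a + (s + 6 * u%:R)) (2 * s + 6 * u%:R).
Proof.
move=> H0 Hs s2 FH; pose n : R := #|V|%:R.
have n0 : 0 < n by rewrite ltr0n; apply/card_gt0P; exists x.
have Hy y : `|H y| <= 2^-1 by apply: le_trans s2; apply: l2_le_coord.
pose q y : R := 2 * H y ^+ 2 + 6 * (u && (y == x))%:R.
have q0 y : 0 <= q y by rewrite addr_ge0 // mulr_ge0 // sqr_ge0.
have [s0 Hs2] := Hs.
have [u0 sumu] : 0 <= 6 * u%:R :> R /\ \sum_(y : V) (u && (y == x))%:R = u%:R :> R.
  split; first by rewrite mulr_ge0.
  rewrite (bigD1 x) //= eqxx andbT big1 ?addr0 // => y /negPf ->.
  by rewrite andbF.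
have ql2 : l2_le q (s + 6 * u%:R).
  apply: l2_le_add.
    apply: l2_le_dom Hs => y; have h := Hy y.
    rewrite normrM normrX [`|2|]ger0_norm // expr2 mulrA -[leRHS]mul1r.
    by rewrite ler_wpM2r //; lra.
  split=> //; rewrite exprMn; under eq_bigr do rewrite exprMn.
  rewrite -mulr_sumr; apply: ler_wpM2l => //.
  rewrite (eq_bigr (fun y : V => (u && (y == x))%:R)); last first.
    by move=> y _; case: (_ && _); rewrite ?expr1n ?expr0n.
  by rewrite sumu; case: (u); rewrite ?expr1n ?expr0n.
pose m := (\sum_y q y) / n.
have m0 : 0 <= m by rewrite divr_ge0 ?sumr_ge0 // ltW.
have sumq : \sum_y q y <= s + 6 * u%:R.
  rewrite big_split /= -!mulr_sumr sumu lerD2r.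
  by apply: le_trans (_ : 2 * s ^+ 2 <= s); [rewrite ler_wpM2l | nra].
have me : 1 + m <= expR ((s + 6 * u%:R) / n).
  apply: le_trans (expR_ge1Dx _) _; rewrite ler_expR.
  by rewrite ler_wpM2r // invr_ge0 ltW.
have m1 : 0 < 1 + m by rewrite ltr_pwDl.
exists (fun y => (H y + q y - m) / (1 + m)); split.
- rewrite -mulr_suml sumrB big_split /= H0 add0r sumr_const -mulr_natr.
  by rewrite mulfVK ?gt_eqF // subrr mul0r.
- have c : l2_le (fun y => H y + q y - m) (2 * s + 6 * u%:R).
    have -> : 2 * s + 6 * u%:R = s + (s + 6 * u%:R) by ring.
    apply: l2_le_center (l2_le_add Hs ql2).
    by rewrite big_split /= H0 add0r -mulr_natr mulfVK ?gt_eqF.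
  apply: l2_le_dom c => y; rewrite normrM ler_piMr // normfV.
  by rewrite gtr0_norm // invf_le1 // lerDl.
move=> y; have /andP[F0 F1] := FH y; rewrite mulr_ge0 ?expR_ge0 //=.
rewrite mulrDl expRD.
have -> : 1 + (H y + q y - m) / (1 + m) = (1 + H y + q y) / (1 + m).
  by field; rewrite gt_eqF.
have Hq0 : 0 <= 1 + H y + q y.
  by have := Hy y; have := q0 y; rewrite ler_norml; lra.
apply: le_trans (_ : expR (a / n) * (1 + H y + q y) <= _); last first.
  rewrite -!mulrA ler_wpM2l ?expR_ge0 // mulrCA ler_peMr //.
  by rewrite ler_pdivlMr // mul1r.
apply: le_trans (ler_wpM2l (expR_ge0 _) F1) _.
rewrite mulrCA ler_wpM2l ?expR_ge0 // /q.
have e0 := expR_ge0 (H y); have e1 := expR_le_quad (Hy y).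
case: (_ && _); last by rewrite expR0 mul1r mulr0 addr0.
have := expR1_le4 R; have := Hy y; rewrite ler_norml => /andP[h1 h2] e4.
apply: le_trans (ler_wpM2r e0 e4) _.
have : 2 * H y ^+ 2 <= 2^-1 by nra.
rewrite mulr1; lra.
Qed.

(** * Recursion along a parent function *)

Lemma parent_ind (W : finType) (root : W) (par : W -> W) (idx : W -> nat)
    (Q : W -> Prop) :
  (forall c, c != root -> (idx (par c) < idx c)%N) ->
  (forall v, (forall c, c != root -> par c = v -> Q c) -> Q v) ->
  forall v, Q v.
Proof.
move=> lt_par step v; pose N := (\max_w idx w).+1.
have : (N <= idx v + N)%N by rewrite leq_addl.
elim: {2}N v => [|k IH] v hv.
  by move: hv; rewrite addn0 ltnNge leq_bigmax.
apply: step => c cr pc; apply: IH; apply: leq_trans hv _.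
by rewrite addnS -addSn leq_add2r -pc lt_par.
Qed.

(** Functions on a rooted tree can be defined from their values at the children.
    The recursion runs on the largest index minus the index of the vertex. *)
Lemma parent_rec (W : finType) (root : W) (par : W -> W) (idx : W -> nat)
    (T : Type) (t0 : T) (Phi : W -> (W -> T) -> T) :
  (forall c, c != root -> (idx (par c) < idx c)%N) ->
  (forall v F G, (forall c, c != root -> par c = v -> F c = G c) ->
     Phi v F = Phi v G) ->
  exists F : W -> T, forall v, F v = Phi v F.
Proof.
move=> lt_par local; pose S F v := Phi v F.
pose N := (\max_w idx w).+1.
exists (iter N S (fun=> t0)) => v.
have : (N <= idx v + N)%N by rewrite leq_addl.
rewrite -[RHS]/(iter N.+1 S (fun=> t0) v).
elim: {2 3 4}N v => [|k IH] v hv.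
  by move: hv; rewrite addn0 ltnNge leq_bigmax.
apply: local => c cr pc; apply: IH; apply: leq_trans hv _.
by rewrite addnS -addSn leq_add2r -pc lt_par.
Qed.

Lemma sum_children (R : realType) (W : finType) (root : W) (par : W -> W)
    (F : W -> R) :
  \sum_v \sum_(c | (c != root) && (par c == v)) F c = \sum_(c | c != root) F c.
Proof. by rewrite [RHS](partition_big par predT). Qed.

(** * The moment generating function of the number of hits *)

(** The bound [b v <= 8] closes the induction: [s <= eps * D * 8 <= 1/2] and
    [b v = 2 * s + 6 * [v in U] <= 7]. *)
Lemma tree_mgf_bound (R : realType) (V W : finType) (K : V -> V -> R) (eps : R)
    (x : V) (root : W) (par : W -> W) (idx : W -> nat) (D : nat) (U : {set W})
    (f : W -> V -> R) :
  doubly_stochastic K -> contracts K eps ->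
  0 <= eps -> eps <= 16^-1 -> eps * D%:R <= 16^-1 ->
  (forall c, c != root -> (idx (par c) < idx c)%N) ->
  (forall v, #|[pred c | (c != root) && (par c == v)]| <= D)%N ->
  (forall v y, f v y = expR ((v \in U) && (y == x))%:R *
     \prod_(c | (c != root) && (par c == v)) kernel_avg K (f c) y) ->
  (\sum_y f root y) / #|V|%:R <= expR (12 * #|U|%:R / #|V|%:R).
Proof.
move=> dsK cK eps0 eps16 epsD lt_par deg fE.
pose ch v c := (c != root) && (par c == v).
have [b bE] : exists b : W -> R, forall v, b v =
    2 * (\sum_(c | ch v c) eps * b c) + 6 * (v \in U)%:R.
  apply: (parent_rec 0 lt_par) => v F G FG; congr (2 * _ + _).
  by apply: eq_bigr => c /andP[cr /eqP pc]; rewrite FG.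
have [a aE] : exists a : W -> R, forall v, a v =
    \sum_(c | ch v c) a c +
    (\sum_(c | ch v c) eps * b c + 6 * (v \in U)%:R).
  apply: (parent_rec 0 lt_par) => v F G FG; congr (_ + _).
  by apply: eq_bigr => c /andP[cr /eqP pc]; rewrite FG.
have main : forall v, near_const (f v) (a v) (b v) /\ 0 <= b v <= 8.
  apply: (parent_ind lt_par) => v IH.
  have s2 : \sum_(c | ch v c) eps * b c <= 2^-1.
    apply: le_trans (_ : \sum_(c | ch v c) eps * 8 <= _).
      apply: ler_sum => c /andP[cr /eqP pc].
      by have [_ /andP[_ ?]] := IH c cr pc; exact: ler_wpM2l.
    rewrite sumr_const -mulr_natr.
    have : eps * #|ch v|%:R <= 16^-1.
      by apply: le_trans epsD; rewrite ler_wpM2l // ler_nat; apply: deg.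
    by move=> ?; lra.
  have [H [H0 Hs FH]] := near_const_prod (P := ch v) (f := fun c => kernel_avg K (f c))
    (a := a) (b := fun c => eps * b c)
    (fun c hc => near_const_avg dsK cK
       (proj1 (IH c (proj1 (andP hc)) (eqP (proj2 (andP hc)))))).
  have s0 : 0 <= \sum_(c | ch v c) eps * b c := proj1 Hs.
  have nc := near_const_step x (v \in U) H0 Hs s2 FH.
  rewrite -aE -bE in nc; split.
    case: nc => g [g0 gb gf]; exists g; split=> // y.
    by rewrite fE; apply: gf.
  have u0 : 0 <= ((v \in U)%:R : R) <= 1 by case: (v \in U); rewrite lexx ler01.
  by rewrite bE; apply/andP; split; lra.
have aroot : a root <= 12 * #|U|%:R.
  (* The coefficient 3 of [s] is absorbed since [3 * eps <= 1]. *)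
  have loc v : a v + b v <=
      \sum_(c | ch v c) (a c + b c) + 12 * (v \in U)%:R.
    have : \sum_(c | ch v c) 3 * (eps * b c) <= \sum_(c | ch v c) b c.
      apply: ler_sum => c _; have [_ /andP[bc _]] := main c.
      by rewrite mulrA ler_piMl //; lra.
    by rewrite -mulr_sumr big_split /= {1}aE {1}bE; lra.
  have tot : \sum_v (a v + b v) <=
      \sum_(c | c != root) (a c + b c) + 12 * #|U|%:R.
    rewrite -(sum_children root par) -sum1_card natr_sum.
    rewrite [\sum_(v in U) _]big_mkcond mulr_sumr -big_split.
    apply: ler_sum => v _; apply: le_trans (loc v) _.
    by rewrite /=; case: (v \in U).
  rewrite (bigD1 root) //= in tot.
  by have [_ /andP[br _]] := main root; lra.
have [[g [g0 _ gf]] _] := main root.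
have n0 : 0 < #|V|%:R :> R by rewrite ltr0n; apply/card_gt0P; exists x.
rewrite ler_pdivrMr //.
apply: le_trans (ler_sum _ (fun y _ => proj2 (andP (gf y)))) _.
rewrite -mulr_sumr big_split /= g0 addr0 sumr_const ler_wpM2r ?ler0n //.
by rewrite ler_expR ler_wpM2r // invr_ge0 ltW.
Qed.

(** * Tree-indexed Markov laws on finite trajectories *)

Definition prefix_agree (W V : finType) (s : seq W) (v : W)
    (f g : {ffun W -> V}) : bool :=
  [forall u, (index u s < index v s)%N ==> (f u == g u)].

(** Marginals are sums over complete trajectories, so that a single finite function
    [mu] replaces the family of conditional laws. *)
Definition tree_markov (R : realType) (W V : finType) (s : seq W) (root : W)
    (par : W -> W) (K : V -> V -> R) (mu : {ffun W -> V} -> R) : Prop :=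
  (forall y, \sum_(f : {ffun W -> V} | f root == y) mu f = #|V|%:R^-1) /\
  forall v, v != root -> forall g y,
    \sum_(f : {ffun W -> V} | prefix_agree s v f g && (f v == y)) mu f =
    (\sum_(f : {ffun W -> V} | prefix_agree s v f g) mu f) * K (g (par v)) y.

(** Replacing [psi (f v)] by its conditional expectation given the past. *)
Lemma markov_condexp (R : realType) (W V : finType) (s : seq W) (root : W)
    (par : W -> W) (K : V -> V -> R) (mu : {ffun W -> V} -> R) (x : V)
    (v : W) (h : {ffun W -> V} -> R) (psi : V -> R) :
  tree_markov s root par K mu ->
  v != root -> (index (par v) s < index v s)%N ->
  (forall f g, prefix_agree s v f g -> h f = h g) ->
  \sum_f mu f * (h f * psi (f v)) =
  \sum_f mu f * (h f * kernel_avg K psi (f (par v))).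
Proof.
move=> [_ mk] vr lt_p hloc.
pose res (f : {ffun W -> V}) : {ffun W -> V} :=
  [ffun u => if (index u s < index v s)%N then f u else x].
have resE f g : res g = g -> (res f == g) = prefix_agree s v f g.
  move=> gK; apply/eqP/forallP => [<- u|fg].
    by apply/implyP=> lt_u; rewrite ffunE lt_u.
  rewrite -gK; apply/ffunP => u; rewrite !ffunE; case: ifP => // lt_u.
  exact/eqP/(implyP (fg u)).
(* [res f = g] groups the trajectories by their past; [g] represents a class when it
   is [x] from [v] on. *)
have resK f : res (res f) = res f.
  by apply/ffunP => u; rewrite !ffunE; case: (index u s < _)%N.
rewrite [LHS](partition_big res predT) //= [RHS](partition_big res predT) //=.
apply: eq_bigr => g _.
case: (eqVneq (res g) g) => gK; last first.
  by rewrite !big_pred0 // => f; apply/eqP => fg; case/eqP: gK; rewrite -fg resK.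
rewrite !(eq_bigl _ _ (fun f => resE f g gK)).
transitivity (\sum_(f | prefix_agree s v f g) h g * (mu f * psi (f v))).
  by apply: eq_bigr => f /hloc ->; rewrite mulrCA.
transitivity (\sum_(f | prefix_agree s v f g) h g * (mu f * kernel_avg K psi (g (par v)))).
  rewrite -!mulr_sumr -mulr_suml; congr (_ * _).
  rewrite (partition_big (fun f : {ffun W -> V} => f v) predT) //= mulr_sumr.
  apply: eq_bigr => y _; rewrite mulrA -mk // mulr_suml.
  by apply: eq_bigr => f /andP[_ /eqP ->].
apply: eq_bigr => f fg; rewrite (hloc f g fg).
by move/forallP: fg => /(_ (par v)); rewrite lt_p /= => /eqP ->; rewrite mulrCA.
Qed.

(** The uniform law is stationary because the columns of [K] sum to 1. *)
Lemma markov_marginal (R : realType) (W V : finType) (s : seq W) (root : W)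
    (par : W -> W) (K : V -> V -> R) (mu : {ffun W -> V} -> R) :
  doubly_stochastic K -> tree_markov s root par K mu ->
  (forall c, c != root -> (index (par c) s < index c s)%N) ->
  forall v y, \sum_(f : {ffun W -> V} | f v == y) mu f = #|V|%:R^-1.
Proof.
move=> [_ _ col] mk lt_par v; have [mk0 _] := mk.
have [k] := ubnP (index v s); elim: k v => // k IH v vk y.
have [->//|vr] := eqVneq v root.
transitivity (\sum_f mu f * (1 * (f v == y)%:R)).
  by rewrite big_mkcond; apply: eq_bigr => f _; case: eqP; rewrite !(mul1r, mulr1, mulr0).
rewrite (markov_condexp y (h := fun=> 1) (fun z => (z == y)%:R) mk vr) ?lt_par //.
transitivity (\sum_(f : {ffun W -> V}) mu f * K (f (par v)) y).
  apply: eq_bigr => f _; rewrite mul1r /kernel_avg (bigD1 y) //= eqxx mulr1 big1 ?addr0 //.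
  by move=> z /negPf ->; rewrite mulr0.
rewrite (partition_big (fun f : {ffun W -> V} => f (par v)) predT) //=.
rewrite -[RHS]mulr1 -[X in _ = _ * X](col y) mulr_sumr; apply: eq_bigr => z _.
rewrite -(IH (par v) _ z) ?(leq_trans (lt_par v vr)) // mulr_suml.
by apply: eq_bigr => f /eqP ->.
Qed.

(** The expectation is unchanged when, from the last vertex to the first, each
    generated vertex is integrated out: it then contributes the factor
    [kernel_avg K (F c)] at its parent. *)
Lemma markov_product (R : realType) (W V : finType) (s : seq W) (root : W)
    (par : W -> W) (K : V -> V -> R) (mu : {ffun W -> V} -> R) (x : V)
    (w F : W -> V -> R) :
  tree_markov s root par K mu ->
  uniq s -> s =i W -> index root s = 0%N ->
  (forall c, c != root -> (index (par c) s < index c s)%N) ->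
  (forall v y, F v y = w v y *
     \prod_(c | (c != root) && (par c == v)) kernel_avg K (F c) y) ->
  \sum_f mu f * \prod_v w v (f v) = (\sum_y F root y) / #|V|%:R.
Proof.
move=> mk us sW s0 lt_par FE; have [mk0 _] := mk.
have inj u v : index u s = index v s -> u = v.
  by move=> uv; rewrite -(nth_index root (sW u)) uv nth_index ?sW.
have rootP u : (index u s < 1)%N = (u == root).
  by rewrite ltnS leqn0 -s0; apply/eqP/eqP => [/inj|->].
(* The vertices not among the first [k] whose parent is; [Z k] is the expectation
   in which every vertex from the [k]-th on has been integrated out. *)
pose open k c := [&& c != root, index (par c) s < k & k <= index c s]%N.
pose Z k := \sum_f mu f * ((\prod_(v | (index v s < k)%N) w v (f v)) *
  \prod_(c | open k c) kernel_avg K (F c) (f (par c))).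
have Z1 : Z 1%N = (\sum_y F root y) / #|V|%:R.
  rewrite /Z mulr_suml (partition_big (fun f : {ffun W -> V} => f root) predT) //=.
  apply: eq_bigr => y _; rewrite -(mk0 y) mulr_sumr; apply: eq_bigr => f /eqP fr.
  rewrite mulrC FE; congr (_ * _ * _).
    by rewrite (eq_bigl (pred1 root)) ?big_pred1_eq ?fr.
  apply: eq_big => [c|c /and3P[_ + _]]; last by rewrite rootP => /eqP ->; rewrite fr.
  rewrite /open rootP; case: eqVneq => //= cr; case: eqP => //= _.
  by rewrite lt0n; apply/eqP => c0; case/eqP: cr; apply: inj; rewrite c0 s0.
have step k : (0 < k < size s)%N -> Z k = Z k.+1.
  case/andP=> k0 ks; pose v := nth root s k.
  have vk : index v s = k by rewrite index_uniq.
  have vr : v != root by apply/eqP => vr; move: k0; rewrite -vk vr s0.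
  (* The branches that are open both before and after [v] is generated. *)
  pose cl c := [&& c != root, index (par c) s < k & k < index c s]%N.
  pose h (f : {ffun W -> V}) := (\prod_(u | (index u s < k)%N) w u (f u)) *
    \prod_(c | cl c) kernel_avg K (F c) (f (par c)).
  have idxE u : (index u s == k) = (u == v).
    by rewrite -vk; apply/eqP/eqP => [/inj|->].
  transitivity (\sum_f mu f * (h f * kernel_avg K (F v) (f (par v)))).
    apply: eq_bigr => f _; congr (_ * _); rewrite /h -mulrA; congr (_ * _).
    rewrite (bigD1 v) /= 1?mulrC; last by rewrite /open vr -{1}vk lt_par //= vk.
    congr (_ * _); apply: eq_bigl => c; rewrite /open /cl -idxE.
    by case: (c != root) => //=; case: (_ < k)%N => //=; rewrite ltn_neqAle eq_sym andbC.
  rewrite -(markov_condexp x (h := h) _ mk vr) ?lt_par //; last first.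
    move=> f g /forallP fg; congr (_ * _); apply: eq_bigr => u.
      by move=> lt_u; move: (fg u); rewrite vk lt_u => /eqP ->.
    by case/and3P => _ lt_u _; move: (fg (par u)); rewrite vk lt_u => /eqP ->.
  apply: eq_bigr => f _; congr (_ * _).
  rewrite [in RHS](bigD1 v) /= ?vk // FE.
  have -> : \prod_(u | (index u s < k.+1)%N && (u != v)) w u (f u) =
      \prod_(u | (index u s < k)%N) w u (f u).
    by apply: eq_bigl => u; rewrite -idxE andbC ltnS -ltn_neqAle.
  rewrite [X in _ = _ * _ * X](bigID (fun c => par c == v)) /=.
  have -> : \prod_(c | open k.+1 c && (par c == v)) kernel_avg K (F c) (f (par c)) =
      \prod_(c | (c != root) && (par c == v)) kernel_avg K (F c) (f v).
    apply: eq_big => [c|c /andP[_ /eqP ->] //]; rewrite /open.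
    case: (boolP (c != root)) => //= cr; case: eqP => [pc|]; last by rewrite andbF.
    by have := lt_par c cr; rewrite pc vk ltnSn /= => ->.
  have -> : \prod_(c | open k.+1 c && (par c != v)) kernel_avg K (F c) (f (par c)) =
      \prod_(c | cl c) kernel_avg K (F c) (f (par c)).
    apply: eq_bigl => c; rewrite /open /cl -idxE; case: (c != root) => //=.
    by rewrite andbAC ltnS [X in X && _]andbC -ltn_neqAle.
  by rewrite /h mulrACA [X in X * _]mulrC [X in _ * X]mulrC.
have Zk k : (k < size s)%N -> Z 1%N = Z k.+1.
  elim: k => [_|k IH ks]; first by [].
  exact: etrans (IH (ltnW ks)) (step k.+1 ks).
have s1 : (0 < size s)%N by rewrite -s0 index_mem sW.
have lt_last : ((size s).-1 < size s)%N by rewrite prednK.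
rewrite -Z1 (Zk _ lt_last) prednK //; apply: eq_bigr => f _; congr (_ * _).
rewrite [X in _ * X]big_pred0 ?mulr1; last first.
  by move=> c; apply/negP => /and3P[_ _]; rewrite leqNgt index_mem sW.
by apply: eq_bigl => u; rewrite index_mem sW.
Qed.

(** * From the random walk to its law on trajectories *)

Definition trajectory (Omega : Type) (W V : finType) (phi : Omega -> W -> V)
    (w : Omega) : {ffun W -> V} := [ffun v => phi w v].

Definition trajectory_law (R : realType) (W V : finType) (disp : measure_display)
    (Omega : measurableType disp) (P : probability Omega R)
    (phi : Omega -> W -> V) (f : {ffun W -> V}) : R :=
  fine (P [set w | forall v, phi w v = f v]).

Lemma trajectory_law_ge0 (R : realType) (W V : finType) (disp : measure_display)
    (Omega : measurableType disp) (P : probability Omega R)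
    (phi : Omega -> W -> V) (f : {ffun W -> V}) : 0 <= trajectory_law P phi f.
Proof. exact: fine_ge0. Qed.

(** As [W] and [V] are finite, this reduces events about the walk to finite sums. *)
Lemma trajectory_lawE (R : realType) (W V : finType) (disp : measure_display)
    (Omega : measurableType disp) (P : probability Omega R)
    (phi : Omega -> W -> V) (Q : pred {ffun W -> V}) :
  (forall v y, measurable [set w | phi w v = y]) ->
  P [set w | Q (trajectory phi w)] = (\sum_(f | Q f) trajectory_law P phi f)%:E.
Proof.
move=> mphi.
pose E (f : {ffun W -> V}) := [set w | forall v, phi w v = f v].
have mE f : measurable (E f).
  have -> : E f = \bigcap_(v in [set: W]) [set w | phi w v = f v].
    by apply/seteqP; split=> [w Ew v _ | w Ew v]; [apply: Ew | apply: (Ew v)].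
  by apply: fin_bigcap_measurable => //; apply: finite_finset.
have toE w f : trajectory phi w = f <-> E f w.
  split=> [<- v|Ew]; first by rewrite ffunE.
  by apply/ffunP => v; rewrite ffunE.
pose S (l : seq {ffun W -> V}) := [set w | Q (trajectory phi w) && (trajectory phi w \in l)].
suff H : forall l, uniq l ->
    measurable (S l) /\ P (S l) = (\sum_(f <- l | Q f) trajectory_law P phi f)%:E.
  have [_ <-] := H _ (index_enum_uniq {ffun W -> V}).
  by congr (P _); apply/seteqP; split=> w; rewrite /S /= mem_index_enum andbT.
elim=> [_|f l IH /= /andP[fl ul]].
  have -> : S [::] = set0 by apply/seteqP; split=> w; rewrite /S /= ?in_nil ?andbF.
  by rewrite big_nil measure0; split=> //; apply: measurable0.
have [mS PS] := IH ul; rewrite big_cons; case: ifP => Qf; last first.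
  suff -> : S (f :: l) = S l by [].
  apply/seteqP; split=> w; rewrite /S /= in_cons.
    by case: eqVneq => //= ->; rewrite Qf.
  by case/andP=> -> ->; rewrite orbT.
have -> : S (f :: l) = E f `|` S l.
  apply/seteqP; split=> w; rewrite /S /= in_cons.
    case/andP=> Qw /orP[/eqP/toE|wl]; first by left.
    by right; apply/andP.
  by case=> [/toE -> |/andP[-> ->]]; rewrite ?Qf ?eqxx ?orbT.
split; first exact: measurableU.
have disj : E f `&` S l = set0.
  apply/seteqP; split=> w //; rewrite /S /= => -[/toE -> /andP[_]]; exact/negP.
rewrite (measureU _ (mE f) mS disj) EFinD -PS; congr (_ + _)%E.
by rewrite /trajectory_law fineK ?fin_num_measure //; apply: mE.
Qed.

Lemma twalk_markov (R : realType) (W : finType) (t : rel W) (root : W)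
    (V : finType) (e : rel V) (disp : measure_display)
    (Omega : measurableType disp) (P : probability Omega R)
    (phi : Omega -> W -> V) (par : W -> W) :
  random_Twalk t root e P phi ->
  (forall v, v != root -> is_parent t root (par v) v) ->
  exists s, generation_order t root s /\
    tree_markov s root par (fun y z => unif_pmf R (nbrs e y) z) (trajectory_law P phi).
Proof.
move=> [mphi [s so [rootP stepP]]] parP; exists s; split=> //; split=> [y|v vr g y].
  apply: EFin_inj; rewrite -(trajectory_lawE P (fun f => f root == y) mphi).
  transitivity (P [set w | phi w root = y]).
    by congr (P _); apply/seteqP; split=> w /=; rewrite ffunE => /eqP.
  by rewrite rootP /unif_pmf finset.in_setT cardsT.
apply: EFin_inj; rewrite EFinM.
rewrite -(trajectory_lawE P (fun f => prefix_agree s v f g && (f v == y)) mphi).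
rewrite -(trajectory_lawE P (fun f => prefix_agree s v f g) mphi).
have agE w : prefix_agree s v (trajectory phi w) g <->
    (forall u, (index u s < index v s)%N -> phi w u = g u).
  split=> [/forallP h u lt_u|h].
    by have := h u; rewrite lt_u ffunE => /eqP.
  by apply/forallP => u; apply/implyP => /h; rewrite ffunE => ->.
have -> : [set w | prefix_agree s v (trajectory phi w) g] =
    [set w | forall u, (index u s < index v s)%N -> phi w u = g u].
  by apply/seteqP; split=> w /= /agE.
rewrite -(stepP v (par v) (parP v vr) g y); congr (P _).
apply/seteqP; split=> w /=.
  by case/andP => /agE h; rewrite ffunE => /eqP.
by case=> /agE -> /=; rewrite ffunE => /eqP.
Qed.

(** The last but one vertex of a shortest walk from the root to [v]. *)
Lemma exists_parent (W : finType) (t : rel W) (root v : W) :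
  symmetric t -> (forall x y : W, connect t x y) -> v != root ->
  exists p, is_parent t root p v.
Proof.
move=> sym conn vr.
have dist_le x k (q : k.-tuple W) : path t root q -> last root q = x ->
    (k < #|W|)%N -> (dist t root x <= k)%N.
  move=> tq lq kW; rewrite leqNgt; apply/negP => /(before_find 0%N).
  rewrite nth_iota // add0n => /existsP; apply.
  by exists q; rewrite tq lq eqxx.
have : has (fun k => [exists p : k.-tuple W, path t root p && (last root p == v)])
    (iota 0 #|W|).
  have /connectP[p tp lp] := conn root v.
  case: (shortenP tp) lp => q tq uq _ lq; apply/hasP; exists (size q).
    by rewrite mem_iota add0n /= -[X in (X <= _)%N]/(size (root :: q))
      -(card_uniqP uq) max_card.
  by apply/existsP; exists (in_tuple q); rewrite tq -lq /=.
move=> hv; have dW : (dist t root v < #|W|)%N.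
  by move: hv; rewrite has_find size_iota.
have /existsP[q /andP[tq /eqP lq]] := nth_find 0%N hv.
rewrite nth_iota // add0n in q tq lq.
case: q tq lq => q /= qsz; case/lastP: q qsz => [|q z] qsz.
  by move=> _ /= rv; rewrite rv eqxx in vr.
rewrite rcons_path last_rcons => /andP[tq tz] zv; rewrite zv in tz.
exists (last root q); rewrite /is_parent sym tz /=.
have qs : (size q < dist t root v)%N by rewrite /dist -(eqP qsz) size_rcons.
apply: (leq_ltn_trans _ qs); apply: (dist_le _ _ (in_tuple q)) => //.
exact: ltn_trans qs dW.
Qed.

Lemma expectation_hits (R : realType) (W V : finType) (disp : measure_display)
    (Omega : measurableType disp) (P : probability Omega R)
    (phi : Omega -> W -> V) (U : {set W}) (x : V) :
  (forall v y, measurable [set w | phi w v = y]) ->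
  ('E_P[fun w => (hits phi U x w)%:R : R] =
   \sum_(u in U) P [set w | phi w u = x])%E.
Proof.
move=> mphi; rewrite unlock.
transitivity (\int[P]_w (\sum_(u <- enum U) (\1_[set w | phi w u = x] w)%:E))%E.
  apply: eq_integral => w _; rewrite sumEFin; congr (_%:E).
  rewrite /hits -sum1_card natr_sum big_enum_cond /= big_mkcond [RHS]big_mkcond /=.
  apply: eq_bigr => u _; rewrite inE andbT; case: (u \in U) => //=.
  by rewrite indicE; case: eqP => h; [rewrite mem_set | rewrite memNset].
rewrite ge0_integral_sum //.
- rewrite big_enum /=; apply: eq_bigr => u _.
  by rewrite integral_indic // setIT.
by move=> u; apply/measurable_EFinP; apply: measurable_indic.
Qed.

(** Chernoff's bound: the indicator of [r < N] is at most [exp (N - r)]. *)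
Lemma hits_tail (R : realType) (W V : finType) (disp : measure_display)
    (Omega : measurableType disp) (P : probability Omega R)
    (phi : Omega -> W -> V) (U : {set W}) (x : V) (r : R) :
  (forall v y, measurable [set w | phi w v = y]) ->
  (P [set w | (r < (hits phi U x w)%:R)%R] <=
   (expR (- r) * \sum_f trajectory_law P phi f *
      \prod_v expR ((v \in U) && (f v == x))%:R)%:E)%E.
Proof.
move=> mphi; pose N (f : {ffun W -> V}) := #|[set u in U | f u == x]%SET|.
have -> : [set w | (r < (hits phi U x w)%:R)%R] =
    [set w | r < (N (trajectory phi w))%:R].
  have hN w : hits phi U x w = N (trajectory phi w).
    by apply: eq_card => u; rewrite !inE ffunE.
  by apply/seteqP; split=> w /=; rewrite hN.
rewrite (trajectory_lawE P (fun f => r < (N f)%:R) mphi) lee_fin.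
rewrite mulr_sumr [leLHS]big_mkcond; apply: ler_sum => f _.
have law0 := trajectory_law_ge0 P phi f.
have -> : \prod_v expR ((v \in U) && (f v == x))%:R = expR (N f)%:R :> R.
  rewrite -expR_sum; congr expR; rewrite /N -sum1_card natr_sum [RHS]big_mkcond.
  by apply: eq_bigr => v _; rewrite inE; case: (_ && _).
rewrite mulrCA -expRD; case: ifP => h; last by rewrite mulr_ge0 ?expR_ge0.
rewrite ler_peMr // -[leLHS]expR0 ler_expR; lra.
Qed.

(** * The concentration bound *)

Theorem lemma1p2 (R : realType) :
  exists K0 alpha : R, [/\ 1 < K0, 0 < alpha &
    forall (W : finType) (t : rel W) (root : W) (D : nat)
           (V : finType) (e : rel V) (n d : nat) (lambda : R),
      tree t -> max_degree t = D ->
      ndl_graph e n d lambda ->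
      ((0 < D)%N -> lambda < alpha * d%:R / D%:R) ->
    forall (U : {set W}) (x : V), U != finset.set0 ->
    forall (disp : measure_display) (Omega : measurableType disp)
           (P : probability Omega R) (phi : Omega -> W -> V),
      random_Twalk t root e P phi ->
      let X : Omega -> R := fun w => (hits phi U x w)%:R in
      ('E_P[X] = (#|U|%:R / n%:R)%:E)%E /\
      forall K : R, K0 < K ->
        (P [set w | (K * fine 'E_P[X] < X w)%R]
           <= (expR (- (K - K0) * fine 'E_P[X]))%:E)%E].
Proof.
exists 12, 16^-1; split; [lra | lra |].
move=> W t root D V e n d lambda tt tD ndl lamD U x _ disp Omega P phi walk X.
have [mphi _] := walk.
have Vn : #|V| = n by case: ndl.
have /choice[par parP] : forall v, exists p, v != root -> is_parent t root p v.
  move=> v; have [->|vr] := eqVneq v root; first by exists root.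
  have [[sym _] conn _] := tt.
  by have [p ?] := exists_parent sym conn vr; exists p.
have [s [[sW s0 ord] mk]] := twalk_markov walk parP.
have lt_par c : c != root -> (index (par c) s < index c s)%N.
  by move=> /parP /andP[_ /ord].
have degP v : (#|[pred c | (c != root) && (par c == v)]| <= D)%N.
  rewrite -tD; apply: leq_trans (leq_bigmax v); apply: subset_leq_card.
  apply/fintype.subsetP => c; rewrite !inE => /andP[cr /eqP <-].
  by have /andP[tc _] := parP c cr; have [[sym _] _ _] := tt; rewrite sym.
have D0root : D = 0%N -> forall c, c = root.
  move=> D0 c; apply/eqP; apply: contraT => cr.
  have := degP (par c); rewrite D0 leqn0 => /eqP/card0_eq/(_ c).
  by rewrite !inE cr eqxx.
have [K [eps [dsK cK mkK [eps0 eps16 epsD]]]] :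
    exists (K : V -> V -> R) (eps : R), [/\ doubly_stochastic K,
      contracts K eps, tree_markov s root par K (trajectory_law P phi) &
      [/\ 0 <= eps, eps <= 16^-1 & eps * D%:R <= 16^-1]].
  (* For [D = 0] the tree is a single vertex, [lambda] need not be small, and every
     kernel describes the walk: averaging over all of [V] contracts with [eps = 0]. *)
  have [D0|D0] := posnP D.
    have n0 : #|V|%:R != 0 :> R.
      by rewrite pnatr_eq0 -lt0n; apply/card_gt0P; exists x.
    exists (fun _ _ => #|V|%:R^-1), 0; split.
    - split=> [y z|y|z]; first by rewrite invr_ge0.
      - by rewrite sumr_const -[LHS]mulr_natr mulVf.
      - by rewrite sumr_const -[LHS]mulr_natr mulVf.
    - move=> g r g0 _; rewrite mul0r; split=> //.
      rewrite big1 ?expr0n // => y _.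
      by rewrite /kernel_avg -mulr_sumr g0 mulr0 expr0n.
    - by split=> [|v]; [case: mk | rewrite (D0root D0 v) eqxx].
    - by rewrite mul0r; split; lra.
  have lam0 := ndl_lambda_ge0 ndl.
  have D1 : 1 <= D%:R :> R by rewrite ler1n.
  have h := lamD D0.
  have h' : lambda * D%:R < 16^-1 * d%:R by rewrite -ltr_pdivlMr //; lra.
  have hl : lambda <= lambda * D%:R by rewrite ler_peMr.
  have d0 : 0 < d%:R :> R by lra.
  exists (fun y z => unif_pmf R (nbrs e y) z), (lambda / d%:R).
  have [sg _ reg _] := ndl.
  split=> //.
  - by apply: (walk_doubly_stochastic _ sg reg); rewrite -(ltr0n R).
  - by apply: (ndl_contracts ndl); lra.
  - split; first by rewrite divr_ge0 // ltW.
    + by rewrite ler_pdivrMr //; lra.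
    + by rewrite mulrAC ler_pdivrMr //; lra.
have EX : ('E_P[X] = (#|U|%:R / n%:R)%:E)%E.
  rewrite expectation_hits //.
  rewrite (eq_bigr (fun=> (n%:R^-1)%:E)) => [|u _].
    by rewrite sumEFin sumr_const mulr_natl.
  rewrite -Vn -(markov_marginal dsK mkK lt_par u x).
  rewrite -(trajectory_lawE P (fun f => f u == x) mphi); congr (P _).
  by apply/seteqP; split=> w /=; rewrite ffunE => /eqP.
split=> // K' hK; rewrite EX /=.
apply: le_trans (hits_tail P U x _ mphi) _; rewrite lee_fin.
pose wt v y : R := expR ((v \in U) && (y == x))%:R.
have [F FE] : exists F : W -> V -> R, forall v, F v = fun y => wt v y *
    \prod_(c | (c != root) && (par c == v)) kernel_avg K (F c) y.
  apply: (parent_rec (fun=> 0) lt_par) => v F G FG; apply/funext => y.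
  by congr (_ * _); apply: eq_bigr => c /andP[cr /eqP pc]; rewrite FG.
have FE' v y : F v y = wt v y *
    \prod_(c | (c != root) && (par c == v)) kernel_avg K (F c) y by rewrite {1}FE.
have us : uniq s by rewrite (perm_uniq sW) enum_uniq.
have ms : s =i W by move=> v; rewrite (perm_mem sW) mem_enum.
have H := markov_product x mkK us ms s0 lt_par FE'.
rewrite /wt in H; rewrite H.
have B := tree_mgf_bound dsK cK eps0 eps16 epsD lt_par degP FE'.
apply: le_trans (ler_wpM2l (expR_ge0 _) B) _.
rewrite -expRD ler_expR Vn; lra.
Qed.
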